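(* Suppose the following three sets of conditions hold. (Smoothness) For each $\tau$, the random function $\mathbb{S}_n(\cdot,\tau)$ is of class $\mathcal{C}^3(\Theta_\zeta)$, $P_0$-a.s., and $\partial_\zeta^k\mathbb{S}_n(\cdot)$, $k\in\{0,1,2,3\}$, can be continuously extended to the boundary of $\Theta$ (the extensions are denoted by the same symbols). (Bounded moments) For every $K>0$, $$\sup_{n}E_0\Big(\sup_{\tau\in\Theta_\tau}|a_n\mathbb{S}_n(\zeta_0,\tau)|^K\Big)+\max_{0\le l\le3}\sup_nE_0\Big(\sup_{\theta\in\Theta}\Big|\frac1{b_n}\partial_\zeta^l\mathbb{S}_n(\theta)\Big|^K\Big)<\infty.$$ (Limits) (a) There exist a non-random function $\mathbb{S}_0:\Theta\to\mathbb{R}^p$ and positive constants $\chi=\chi(\theta_0)$ and $\epsilon_0$ such that: $\mathbb{S}_0(\zeta_0,\tau)=0$ for every $\tau$; $\sup_\theta|\mathbb{S}_0(\theta)|<\infty$; $|\mathbb{S}_0(\theta)|^2\ge\chi|\zeta-\zeta_0|^2$ for every $\theta=(\zeta,\tau)\in\Theta$; and for every $K>0$, $$\sup_nE_0\Big\{\sup_{\theta\in\Theta}\Big|b_n^{\epsilon_0}\Big(\frac1{b_n}\mathbb{S}_n(\theta)-\mathbb{S}_0(\theta)\Big)\Big|^K\Big\}<\infty.$$ (b) There exist non-random functions $\mathbb{S}'_{1,0}(\zeta_0,\cdot),\dots,\mathbb{S}'_{p,0}(\zeta_0,\cdot):\Theta_\tau\to\mathbb{R}^{p_\zeta}$ and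 a positive constant $\epsilon_1$ such that: $\max_{1\le k\le p}\sup_\tau|\mathbb{S}'_{k,0}(\zeta_0,\tau)|<\infty$; the minimum eigenvalue of the matrix $$\Gamma_0(\tau):=2\sum_{k=1}^p\{\mathbb{S}'_{k,0}(\zeta_0,\tau)\}^{\otimes2}$$ is bounded away from zero uniformly in $\tau\in\overline{\Theta_\tau}$; and for every $K>0$ and $k=1,\dots,p$, $$\sup_nE_0\Big\{\sup_{\tau\in\Theta_\tau}\Big|b_n^{\epsilon_1}\Big(\frac1{b_n}\partial_\zeta\mathbb{S}_{k,n}(\zeta_0,\tau)-\mathbb{S}'_{k,0}(\zeta_0,\tau)\Big)\Big|^K\Big\}<\infty.$$ Then the polynomial type large deviation inequality holds for any $M>0$: for every $M>0$ there exists a constant $C_M>0$ such that $$\sup_{n\in\mathbb{N}}P_0\Big(\sup_{|u|>r}\ \sup_{\tau\in\Theta_\tau}\mathbb{Z}_n(u;\tau)\ge e^{-r}\Big)\le\frac{C_M}{r^M},\qquad r>0.$$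
   Context: $\Theta=\Theta_\zeta\times\Theta_\tau$ with $\Theta_\zeta\subset\mathbb{R}^{p_\zeta}$ and $\Theta_\tau\subset\mathbb{R}^{p_\tau}$ bounded convex domains; points are written $\theta=(\zeta,\tau)$, and $\theta_0=(\zeta_0,\tau_0)\in\Theta$ is a fixed true parameter value. $P_0=P_{\theta_0}$ is the underlying probability measure, with expectation $E_0$. $(b_n)_{n\in\mathbb{N}}$ is a sequence of positive constants with $b_n\to\infty$ (possibly depending on $\theta_0$) and $a_n:=b_n^{-1/2}$. $\mathbb{S}_n=(\mathbb{S}_{k,n})_{k=1}^p:\Theta_\zeta\times\Theta_\tau\to\mathbb{R}^p$ is a continuous random function for each $n$, and $$\mathbb{H}_n(\zeta,\tau)=-\frac1{b_n}|\mathbb{S}_n(\zeta,\tau)|^2,\qquad\mathbb{Z}_n(u;\tau)=\exp\{\mathbb{H}_n(\zeta_0+a_nu,\tau)-\mathbb{H}_n(\zeta_0,\tau)\}$$ for $u\in\{v\in\mathbb{R}^{p_\zeta}:\zeta_0+a_nv\in\Theta_\zeta\}$. The supremum over $|u|>r$ is over $u$ in this set (and the event is empty if there is no such $u$). For a column vector $v$, $v^{\otimes2}=vv^\top$. $\overline{\Theta_\tau}$ denotes the closure of $\Theta_\tau$. *)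

(* Defs.v *)
From HB Require Import structures.
From mathcomp Require Import all_boot all_order all_algebra.
From mathcomp Require Import all_classical all_reals all_analysis.

Set Implicit Arguments.
Unset Strict Implicit.
Unset Printing Implicit Defensive.

Import Order.TTheory GRing.Theory Num.Theory.
Import numFieldNormedType.Exports.

Local Open Scope classical_set_scope.
Local Open Scope ring_scope.

(* MathComp-Analysis over R : realType.  Vectors of R^q are row vectors
   'rV[R]_q; the library norm `|v| on them is the max norm, hence [enorm]. *)
Definition enorm (R : realType) (q : nat) (v : 'rV[R]_q) : R :=
  Num.sqrt (\sum_(i < q) v 0 i ^+ 2).

Definition esup (R : realType) (X : Type) (A : set X) (f : X -> R) : \bar R :=
  ereal_sup [set (f x)%:E | x in A].

Definition bounded_convex_domain (R : realType) (q : nat) (U : set 'rV[R]_q) :=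
  [/\ U !=set0, open U, convex_set U & bounded_set U].

(* Iterated partial derivative: [pderiv [:: i1; ...; il] f] is
   d_i1 (... (d_il f)).  As f is a total function, it is meaningful at the
   points of an open set on which f is regular enough. *)
Definition pderiv (R : realType) (q p : nat) (s : seq 'I_q)
    (f : 'rV[R]_q -> 'rV[R]_p) : 'rV[R]_q -> 'rV[R]_p :=
  foldr (fun i g => 'D_(delta_mx 0 i) g) f s.

Definition class_C (R : realType) (q p : nat) (k : nat) (U : set 'rV[R]_q)
    (f : 'rV[R]_q -> 'rV[R]_p) : Prop :=
  (forall (s : seq 'I_q) (i : 'I_q) (z : 'rV[R]_q), (size s < k)%N -> U z ->
     derivable (pderiv s f) z (delta_mx 0 i)) /\
  (forall s : seq 'I_q, (size s <= k)%N -> {within U, continuous (pderiv s f)}).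

(* Euclidean norm of the array of all partial derivatives of order l. *)
Definition deriv_norm (R : realType) (q p : nat) (l : nat)
    (f : 'rV[R]_q -> 'rV[R]_p) (z : 'rV[R]_q) : R :=
  Num.sqrt (\sum_(s : l.-tuple 'I_q) enorm (pderiv s f z) ^+ 2).

Definition gradient (R : realType) (q : nat) (f : 'rV[R]_q -> R)
    (z : 'rV[R]_q) : 'rV[R]_q :=
  \row_(i < q) 'D_(delta_mx 0 i) f z.

Definition min_eigenvalue (R : realType) (q : nat) (A : 'M[R]_q) : R :=
  inf [set a : R | eigenvalue A a].

(* v^{\otimes 2} = v v^T for the column vector whose transpose is the row v. *)
Definition tensor2 (R : realType) (q : nat) (v : 'rV[R]_q) : 'M[R]_q :=
  v^T *m v.

Section Model.
Context (R : realType) (d : measure_display) (T : measurableType d)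
  (P : probability T R) (pz pt p : nat)
  (Tz : set 'rV[R]_pz) (Tt : set 'rV[R]_pt) (z0 : 'rV[R]_pz)
  (b : nat -> R) (S : nat -> T -> 'rV[R]_pz * 'rV[R]_pt -> 'rV[R]_p).

Definition Theta : set ('rV[R]_pz * 'rV[R]_pt) := Tz `*` Tt.

Definition rate (n : nat) : R := b n `^ (- 2^-1).

(* The values of S outside Theta are irrelevant. *)
Definition continuous_random_functions : Prop :=
  (forall n th k, Theta th -> measurable_fun setT (fun w => S n w th 0 k)) /\
  (forall n w, {within Theta, continuous (S n w)}).

Definition Hfield (n : nat) (w : T) (z : 'rV[R]_pz) (t : 'rV[R]_pt) : R :=
  - ((b n)^-1 * enorm (S n w (z, t)) ^+ 2).

Definition Zfield (n : nat) (w : T) (u : 'rV[R]_pz) (t : 'rV[R]_pt) : R :=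
  expR (Hfield n w (z0 + rate n *: u) t - Hfield n w z0 t).

Definition smoothness : Prop :=
  forall n,
    (forall t, Tt t ->
       {ae P, forall w, class_C 3 Tz (fun z => S n w (z, t))}) /\
    {ae P, forall w, forall s : seq 'I_pz, (size s <= 3)%N ->
       exists g : 'rV[R]_pz * 'rV[R]_pt -> 'rV[R]_p,
         {within closure Theta, continuous g} /\
         (forall z t, Theta (z, t) ->
            g (z, t) = pderiv s (fun z' => S n w (z', t)) z)}.

Definition bounded_moments : Prop :=
  forall K : R, 0 < K ->
  (ereal_sup (range (fun n =>
     \int[P]_w esup Tt (fun t => (enorm (rate n *: S n w (z0, t)) `^ K)%R)))
   + \big[maxe/-oo]_(l < 4)
       ereal_sup (range (fun n =>
         \int[P]_w esup Theta (fun th =>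
           (((b n)^-1 * deriv_norm l (fun z => S n w (z, th.2)) th.1) `^ K)%R)))
   < +oo)%E.

Definition limit_of_S : Prop :=
  exists (S0 : 'rV[R]_pz * 'rV[R]_pt -> 'rV[R]_p) (chi eps0 : R),
  [/\ 0 < chi /\ 0 < eps0,
      (forall t, Tt t -> S0 (z0, t) = 0),
      (esup Theta (fun th => enorm (S0 th)) < +oo)%E,
      (forall z t, Theta (z, t) ->
         chi * enorm (z - z0) ^+ 2 <= enorm (S0 (z, t)) ^+ 2) &
      forall K : R, 0 < K ->
        (ereal_sup (range (fun n =>
           \int[P]_w esup Theta (fun th =>
             (enorm (b n `^ eps0 *: ((b n)^-1 *: S n w th - S0 th)) `^ K)%R)))
         < +oo)%E].

Definition Gamma0 (dS0 : 'I_p -> 'rV[R]_pt -> 'rV[R]_pz) (t : 'rV[R]_pt)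
  : 'M[R]_pz := 2 *: \sum_(k < p) tensor2 (dS0 k t).

(* The limits dS0 k are given on Tt, whereas Gamma0 is evaluated on its
   closure.  The boundary values of the total functions dS0 k, e.g. those of
   their continuous extensions, are only subject to the eigenvalue bound. *)
Definition limit_of_gradient : Prop :=
  exists (dS0 : 'I_p -> 'rV[R]_pt -> 'rV[R]_pz) (eps1 : R),
  [/\ 0 < eps1,
      (\big[maxe/-oo]_(k < p) esup Tt (fun t => enorm (dS0 k t)) < +oo)%E,
      (exists2 lambda : R, 0 < lambda &
         forall t, closure Tt t -> lambda <= min_eigenvalue (Gamma0 dS0 t)) &
      forall (K : R) (k : 'I_p), 0 < K ->
        (ereal_sup (range (fun n =>
           \int[P]_w esup Tt (fun t =>
             (enorm (b n `^ eps1 *: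
                ((b n)^-1 *: gradient (fun z => S n w (z, t) 0 k : R) z0
                 - dS0 k t)) `^ K)%R)))
         < +oo)%E].

(* If no u satisfies the constraints, the outer supremum is -oo and the event
   is empty. *)
Definition large_deviation_event (n : nat) (r : R) : set T :=
  [set w | ((expR (- r))%:E <=
    ereal_sup [set esup Tt (Zfield n w u) | u in
      [set u : 'rV[R]_pz | (Tz (z0 + rate n *: u) /\ r < enorm u)%R]])%E].

Definition polynomial_large_deviation : Prop :=
  forall M : R, 0 < M ->
  exists2 C : R, 0 < C &
    forall r : R, 0 < r ->
      (ereal_sup (range (fun n => P (large_deviation_event n r)))
       <= (C / r `^ M)%:E)%E.

End Model.

(* Main.v *)
(* Write v = a_n u = zeta - zeta_0 and x = |v|, so that sqrt(b_n) x > r, and let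
   Delta bound the diameter of Theta_zeta, so that r < Delta sqrt(b_n).  If
   Z_n >= e^-r at some point, then sqrt(b_n) |S_n / b_n| is at most a small
   multiple of r + |a_n S_n(zeta_0, tau)| there.  This forces one of four
   deviations, each of probability O(r^-M) by Markov's inequality:
   - |a_n S_n(zeta_0, .)| is at least of order r;
   - when x >= r^-eps0, as |S_0| >= sqrt(chi) x, the scaled error of S_n / b_n as
     an estimate of S_0 is at least of order b_n^eps0 x, hence r^eps0;
   - when x < r^-eps0, a first order Taylor expansion at zeta_0 and the
     nondegeneracy of Gamma_0 show that either the remainder is of order x, so
     that the second derivatives of S_n / b_n reach the order 1/x > r^eps0, or
     the scaled error of the gradient is of order b_n^eps1, hence r^(2 eps1).
   The suprema in the moment conditions need not be measurable; all events are
   therefore countable unions over rational points, where almost surely all the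
   fields are smooth in zeta. *)
Require Import Defs.
From HB Require Import structures.
From mathcomp Require Import all_boot all_order all_algebra.
From mathcomp Require Import all_classical all_reals all_analysis.
From mathcomp Require Import measurable_realfun.
From mathcomp Require Import ring lra.

Set Implicit Arguments.
Unset Strict Implicit.
Unset Printing Implicit Defensive.

Import Order.TTheory GRing.Theory Num.Theory.
Import numFieldNormedType.Exports.

Local Open Scope classical_set_scope.
Local Open Scope ring_scope.

(** * Euclidean norm and tail bounds *)

Lemma sum_sqr_le (R : realDomainType) (p : nat) (f : 'I_p -> R) (m : R) :
  (forall k, `|f k| <= m) -> \sum_(k < p) f k ^+ 2 <= p%:R * m ^+ 2.
Proof.
move=> fm; rewrite -[p in p%:R]card_ord mulr_natl -sumr_const.
apply: ler_sum => k _; rewrite -real_normK ?num_real//.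
by rewrite ler_pXn2r ?nnegrE ?(le_trans _ (fm k)).
Qed.

Section Enorm.
Context (R : realType) (q : nat).
Implicit Types v : 'rV[R]_q.

Lemma enorm_ge0 v : 0 <= enorm v.
Proof. exact: sqrtr_ge0. Qed.

Lemma sqr_enorm v : enorm v ^+ 2 = \sum_(i < q) v 0 i ^+ 2.
Proof. by rewrite sqr_sqrtr// sumr_ge0// => i _; exact: sqr_ge0. Qed.

Lemma coord_le_enorm v i : `|v 0 i| <= enorm v.
Proof.
rewrite -(@ler_pXn2r _ 2) ?nnegrE ?enorm_ge0// sqr_enorm real_normK ?num_real//.
by rewrite (bigD1 i)//= lerDl sumr_ge0// => j _; exact: sqr_ge0.
Qed.

Lemma sqr_enorm_le v m : (forall i, `|v 0 i| <= m) ->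
  enorm v ^+ 2 <= q%:R * m ^+ 2.
Proof. by rewrite sqr_enorm; exact: sum_sqr_le. Qed.

Lemma enormZ a v : enorm (a *: v) = `|a| * enorm v.
Proof.
apply/eqP; rewrite -(@eqrXn2 _ 2)// ?enorm_ge0 ?mulr_ge0 ?enorm_ge0//.
rewrite exprMn !sqr_enorm real_normK ?num_real// mulr_sumr.
by apply/eqP/eq_bigr => i _; rewrite mxE exprMn.
Qed.

Lemma continuous_enorm : continuous (@enorm R q).
Proof.
move=> v; rewrite /enorm.
apply: (@continuous_comp _ _ _ (fun u : 'rV[R]_q => \sum_(i < q) u 0 i ^+ 2)
  Num.sqrt); last exact: sqrt_continuous.
have : continuous (fun u : 'rV[R]_q => \sum_(i < q) u 0 i ^+ 2); last exact.
apply: continuous_big => [|i _]; first exact: add_continuous.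
move=> {}v.
apply: (@continuous_comp _ _ _ (fun w : 'rV[R]_q => w 0 i) (fun x => x ^+ 2)).
  exact: coord_continuous.
exact: exprn_continuous.
Qed.

End Enorm.

Section Tail.
Import HBNNSimple.

(* The integrand need not be measurable: the integral of a nonnegative function
   is a supremum over the simple functions below it, hence Markov's inequality
   holds for the measurable sets on which the integrand is large. *)
Lemma integral_esup_tail (R : realType) (d : measure_display)
    (T : measurableType d) (P : probability T R) (X : Type) (A : set X)
    (f : T -> X -> R) (K C c : R) (B : set T) :
  A !=set0 -> 0 <= K -> 0 < c ->
  (\int[P]_w esup A (fun x => (f w x `^ K)%R) <= C%:E)%E ->
  measurable B -> (forall w, B w -> exists2 x, A x & c <= f w x) ->
  (P B <= (C / c `^ K)%:E)%E.
Proof.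
move=> [a Aa] K0 c0 intC mB Bf.
(* Uses a point of [A]: the supremum over an empty set would be [-oo]. *)
have F0 w : (0 <= esup A (fun x => (f w x `^ K)%R))%E.
  by apply: le_ereal_sup_tmp; exists (f w a `^ K)%:E;
    [exists a|rewrite lee_fin powR_ge0].
have cK0 : 0 < c `^ K by exact: powR_gt0.
rewrite EFinM lee_pdivlMr// muleC.
apply: le_trans intC; rewrite ge0_integralTE//.
(* This simple function equals [c] to the power [K] on [B] and 0 elsewhere, so it lies below the
   integrand. *)
pose h := scale_nnsfun (indic_nnsfun R mB) (ltW cK0).
apply: le_ereal_sup_tmp; exists (sintegral P h).
  exists h => [w|//]; rewrite [h w](_ : _ = c `^ K * \1_B w)// indicE.
  have [/set_mem/Bf[x Ax cx]|] := boolP (w \in B); last by rewrite mulr0.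
  rewrite mulr1; apply: le_ereal_sup_tmp.
  exists (f w x `^ K)%:E; first by exists x.
  by rewrite lee_fin ge0_ler_powR// nnegrE ?ltW// (lt_le_trans _ cx).
rewrite (_ : (h : T -> R) = (cst (c `^ K) \* indic_nnsfun R mB)%R)//.
by rewrite sintegralrM sintegral_indic.
Qed.

End Tail.

(** * Smallest eigenvalue of a symmetric matrix *)

Section Rayleigh.
Context (R : realType) (q : nat).
Implicit Types (A : 'M[R]_q) (u v w : 'rV[R]_q).

Lemma sqr_enorm_dot v : enorm v ^+ 2 = (v *m v^T) 0 0.
Proof. by rewrite sqr_enorm mxE; apply: eq_bigr => i _; rewrite mxE expr2. Qed.

Lemma enorm_eq0 v : enorm v = 0 -> v = 0.
Proof.
move=> v0; apply/rowP => i; rewrite mxE; apply/eqP.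
by rewrite -normr_le0 -v0 coord_le_enorm.
Qed.

Lemma continuous_quadratic_form A :
  continuous (fun v => (v *m A *m v^T) 0 0 : R).
Proof.
have -> : (fun v => (v *m A *m v^T) 0 0) =
    (fun v : 'rV[R]_q => \sum_(j < q) (\sum_(i < q) v 0 i * A i j) * v 0 j).
  by apply/funext => v; rewrite mxE; apply: eq_bigr => j _; rewrite !mxE.
apply: continuous_big => [|j _]; first exact: add_continuous.
have cj i : continuous (fun v : 'rV[R]_q => v 0 i) by exact: coord_continuous.
have cs : continuous (fun v : 'rV[R]_q => \sum_(i < q) v 0 i * A i j).
  apply: continuous_big => [|i _ v]; first exact: add_continuous.
  by apply: continuousM; [exact: cj|exact: cst_continuous].
by move=> v; apply: continuousM; [exact: cs|exact: cj].
Qed.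

Lemma enorm_sphere_compact : compact [set v : 'rV[R]_q | enorm v = 1].
Proof.
apply: bounded_closed_compact.
  exists 1; split => // x x1 v /= v1; apply: le_trans (ltW x1).
  rewrite {1}/Num.norm /= mx_normrE; apply/bigmax_leP; split => // -[i j] _ /=.
  by rewrite ord1 -v1 coord_le_enorm.
rewrite (_ : [set v | _] = @enorm R q @^-1` [set 1])//.
by apply: closed_comp => [v _|]; [exact: continuous_enorm|exact: closed_eq].
Qed.

(* The minimum of the quadratic form on the unit sphere is an eigenvalue: the
   first variation at a minimiser [u] in the direction [w] is [|w|^2]. *)
Lemma min_eigenvalue_le A v : A^T = A ->
  min_eigenvalue A * enorm v ^+ 2 <= (v *m A *m v^T) 0 0.
Proof.
move=> symA; have [->|v0] := eqVneq v 0.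
  by rewrite !mul0mx sqr_enorm_dot mul0mx mxE mulr0.
have pos w : w != 0 -> 0 < enorm w.
  by move=> w0; rewrite lt0r enorm_ge0 andbT; apply: contra_neq w0 => /enorm_eq0.
have unit w : w != 0 -> enorm ((enorm w)^-1 *: w) = 1.
  by move=> /pos w0; rewrite enormZ ger0_norm ?invr_ge0 ?enorm_ge0// mulVf ?gt_eqF.
pose Q w : R := (w *m A *m w^T) 0 0.
have QZ a w : Q (a *: w) = a ^+ 2 * Q w.
  by rewrite /Q linearZ/= -!scalemxAl -scalemxAr !mxE expr2 mulrA.
have [|u /set_mem/= u1 umin] := EVT_min_rV _ enorm_sphere_compact
    (continuous_subspaceT (@continuous_quadratic_form A)).
  by exists ((enorm v)^-1 *: v); exact: unit.
set m := (u *m A *m u^T) 0 0 in umin.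
have mQ w : m * enorm w ^+ 2 <= Q w.
  have [->|w0] := eqVneq w 0.
    by rewrite /Q !mul0mx sqr_enorm_dot mul0mx mxE mulr0.
  have := umin ((enorm w)^-1 *: w); rewrite inE /= => /(_ (unit _ w0)).
  rewrite -/(Q ((enorm w)^-1 *: w)) QZ exprVn mulrC -ler_pdivrMr.
    by rewrite invrK.
  by rewrite invr_gt0 exprn_gt0// pos.
apply: le_trans (mQ v); rewrite ler_wpM2r ?sqr_ge0//.
(* It remains to see that [m] is an eigenvalue and, so that the [inf] is a genuine lower bound, that
   no eigenvalue is smaller; the latter is [mQ] at an eigenvector. *)
apply: ge_inf; last first.
  apply/eigenvalueP; exists u; last first.
    apply/eqP => u0; move: u1 => /esym/eqP.
    rewrite u0 -(@eqrXn2 _ 2)// ?enorm_ge0// sqr_enorm_dot mul0mx mxE expr1n.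
    by rewrite oner_eq0.
  set w := u *m A - m *: u.
  suff w0 : w = 0 by apply/eqP; rewrite -subr_eq0 -/w w0.
  apply: enorm_eq0; apply/eqP; rewrite -sqrf_eq0; apply/eqP.
  set N := enorm w ^+ 2; pose C := Q w - m * N.
  have C0 : 0 <= C by rewrite subr_ge0 mQ.
  (* There is no constant term because [u] is a minimiser of norm 1; symmetry of [A] makes the
     linear coefficient [2 * N]. *)
  have expand s : Q (u + s *: w) - m * enorm (u + s *: w) ^+ 2 =
      2 * s * N + s ^+ 2 * C.
    have tr (x y : 'rV[R]_q) : (x *m A *m y^T) 0 0 = (y *m A *m x^T) 0 0.
      have -> : (y *m A *m x^T) 0 0 = (y *m A *m x^T)^T 0 0 by rewrite [RHS]mxE.
      by rewrite !trmx_mul trmxK symA mulmxA.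
    have tr1 (x y : 'rV[R]_q) : (x *m y^T) 0 0 = (y *m x^T) 0 0.
      have -> : (y *m x^T) 0 0 = (y *m x^T)^T 0 0 by rewrite [RHS]mxE.
      by rewrite trmx_mul trmxK.
    have linl (x y z : 'rV[R]_q) : ((x + s *: y) *m A *m z^T) 0 0 =
        (x *m A *m z^T) 0 0 + s * (y *m A *m z^T) 0 0.
      by rewrite !mulmxDl -!scalemxAl !mxE.
    have linl1 (x y z : 'rV[R]_q) : ((x + s *: y) *m z^T) 0 0 =
        (x *m z^T) 0 0 + s * (y *m z^T) 0 0.
      by rewrite mulmxDl -scalemxAl !mxE.
    have NE : N = (u *m A *m w^T) 0 0 - m * (u *m w^T) 0 0.
      by rewrite /N sqr_enorm_dot {1}/w mulmxBl -scalemxAl !mxE.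
    have um : (u *m u^T) 0 0 = 1 by rewrite -sqr_enorm_dot u1 expr1n.
    have linr (x y z : 'rV[R]_q) : (z *m A *m (x + s *: y)^T) 0 0 =
        (z *m A *m x^T) 0 0 + s * (z *m A *m y^T) 0 0.
      by rewrite [LHS]tr linl tr [X in s * X]tr.
    have linr1 (x y z : 'rV[R]_q) : (z *m (x + s *: y)^T) 0 0 =
        (z *m x^T) 0 0 + s * (z *m y^T) 0 0.
      by rewrite [LHS]tr1 linl1 tr1 [X in s * X]tr1.
    rewrite /C /Q sqr_enorm_dot linl !linr linl1 !linr1 um -/m (tr w u) (tr1 w u).
    rewrite /N sqr_enorm_dot in NE *.
    rewrite [in X in 2 * s * X]NE.
    ring.
  (* A negative step of this size makes the expansion strictly negative unless [N = 0]; [C + 1]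
     replaces [C], which may vanish. *)
  have := expand (- N / (C + 1)).
  have : 0 <= Q (u + (- N / (C + 1)) *: w)
      - m * enorm (u + (- N / (C + 1)) *: w) ^+ 2 by rewrite subr_ge0 mQ.
  move=> /[swap] ->.
  have C1 : 0 < C + 1 by lra.
  have -> : 2 * (- N / (C + 1)) * N + (- N / (C + 1)) ^+ 2 * C =
      - (N ^+ 2 * (C + 2)) / (C + 1) ^+ 2 by field; rewrite gt_eqF.
  rewrite mulNr oppr_ge0 pmulr_lle0 ?invr_gt0 ?exprn_gt0// => N2.
  apply/eqP; rewrite -sqrf_eq0; apply/eqP/le_anti; rewrite sqr_ge0 andbT.
  by rewrite -(@pmulr_lle0 _ (C + 2))//; lra.
exists m => a /eigenvalueP[w wA w0].
have := mQ w; rewrite /Q wA -scalemxAl mxE -sqr_enorm_dot ler_pM2r//.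
by rewrite exprn_gt0// pos.
Qed.

End Rayleigh.

(** * Taylor expansion along coordinate paths *)

Section Taylor.
Context (R : realType).

(** Both derivatives are limits of the same difference quotient. *)
Lemma is_derive_line (V : normedModType R) (f : V -> R) (y e : V) (s : R) :
  derivable f (y + s *: e) e ->
  is_derive s (1 : R) (fun t : R => f (y + t *: e)) ('D_e f (y + s *: e)).
Proof.
move=> df.
have E : (fun h : R => h^-1 *: (((fun t : R => f (y + t *: e)) \o shift s)
              (h *: (1 : R)) - f (y + s *: e))) =
          (fun h => h^-1 *: ((f \o shift (y + s *: e)) (h *: e) - f (y + s *: e))).
  apply/funext => h /=; congr (_ *: (f _ - _)).
  by rewrite scalerDl [_ *: (1 : R)]mulr1 addrCA.
by apply: DeriveDef; [rewrite /derivable E|rewrite /derive E].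
Qed.

Lemma MVT_line (V : normedModType R) (f : V -> R) (y e : V) (h : R) :
  (forall s, `|s| <= `|h| -> derivable f (y + s *: e) e) ->
  exists2 s, `|s| <= `|h| &
    f (y + h *: e) - f y = 'D_e f (y + s *: e) * h.
Proof.
move=> df; pose g (t : R) := f (y + t *: e).
have dg (s : R) : `|s| <= `|h| -> is_derive s (1 : R) g ('D_e f (y + s *: e)).
  by move=> /df; exact: is_derive_line.
have cg a b : (forall x, x \in `[a, b] -> `|x| <= `|h|) ->
    {within `[a, b], continuous g}.
  by move=> ab; apply: derivable_within_continuous => x /ab/dg[].
have fy : f y = g 0 by rewrite /g scale0r addr0.
pose MVT_seg := @MVT_segment R g (fun s => 'D_e f (y + s *: e)).
(* The mean value theorem needs ordered endpoints, so the sign of [h] decides between the segments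
   from 0 to [h] and from [h] to 0. *)
have [h0|/ltW h0] := leP 0 h.
  have sub x : x \in `[0, h] -> `|x| <= `|h|.
    by rewrite in_itv/= => /andP[x0 xh]; rewrite !ger0_norm.
  have [|s /sub sh sE] := MVT_seg _ _ h0 _ (cg _ _ sub).
    by move=> x /subset_itv_oo_cc/sub; exact: dg.
  by exists s => //; rewrite fy -/(g h) sE subr0.
have sub x : x \in `[h, 0] -> `|x| <= `|h|.
  by rewrite in_itv/= => /andP[x0 xh]; rewrite !ler0_norm// lerN2.
have [|s /sub sh sE] := MVT_seg _ _ h0 _ (cg _ _ sub).
  by move=> x /subset_itv_oo_cc/sub; exact: dg.
by exists s => //; rewrite fy -/(g h) -opprB sE sub0r mulrN opprK.
Qed.

Variable q : nat.
Implicit Types (f : 'rV[R]_q -> R) (z h : 'rV[R]_q).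

(** Symmetric about [z], so the signs of the coordinates of [h] do not matter; it contains the path
    along the axes from [z] to [z + h], and also [box z (y - z)] for each of its points [y]. *)
Definition box z h : set 'rV[R]_q :=
  [set y | forall i, `|(y - z) 0 i| <= `|h 0 i|].

(** The mean value theorem is applied on each edge of a path parallel to the axes, so partial
    derivatives suffice. The free [c] is taken to be the gradient at [z] for a Taylor remainder and
    0 for a Lipschitz bound. *)
Lemma increment_le f z h (c M : 'I_q -> R) :
  (forall y i, box z h y -> derivable f y (delta_mx 0 i)) ->
  (forall y i, box z h y -> `|'D_(delta_mx 0 i) f y - c i| <= M i) ->
  `|f (z + h) - f z - \sum_(i < q) c i * h 0 i| <= \sum_(i < q) M i * `|h 0 i|.
Proof.
move=> df fM.
(* the polygonal path from [z] to [z + h] along the coordinate axes *)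
pose y j : 'rV[R]_q := z + \row_i (if (i < j)%N then h 0 i else 0).
have ybox (j : nat) (i : 'I_q) (s : R) : i = j :> nat -> `|s| <= `|h 0 i| ->
    box z h (y j + s *: delta_mx 0 i).
  move=> ij sh k; rewrite /y addrAC [z + _]addrC addrK !mxE eqxx/=.
  have [->|ki] := eqVneq k i; first by rewrite ij ltnn add0r mulr1.
  by rewrite mulr0 addr0; case: ifP; rewrite // normr0.
have step (j : 'I_q) :
    `|f (y j.+1) - f (y j) - c j * h 0 j| <= M j * `|h 0 j|.
  have -> : y j.+1 = y j + h 0 j *: delta_mx 0 j.
    rewrite /y -addrA; congr (_ + _); apply/rowP => k; rewrite !mxE eqxx/= ltnS.
    rewrite leq_eqVlt; have [->|kj] := eqVneq k j.
      by rewrite eqxx ltnn mulr1 add0r.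
    by rewrite (inj_eq val_inj) (negbTE kj) mulr0 addr0.
  have [s sh ->] := @MVT_line _ f (y j) (delta_mx 0 j) (h 0 j)
    (fun s sh => df _ _ (ybox j j s erefl sh)).
  by rewrite -mulrBl normrM ler_wpM2r//; exact/fM/ybox.
have -> : f (z + h) - f z = \sum_(j < q) (f (y j.+1) - f (y j)).
  rewrite -(big_mkord xpredT (fun j => f (y j.+1) - f (y j))) telescope_sumr//.
  congr (f _ - f _); apply/rowP => i; rewrite !mxE ?ltn_ord//.
  by rewrite ltn0 addr0.
by rewrite -sumrB (le_trans (ler_norm_sum _ _ _))// ler_sum.
Qed.

(** [increment_le] is used twice: with [c = 0] on each [g i], to bound its variation over the box by
    [M * s], then on [f] with [c i = g i z]. *)
Lemma taylor1_le f (g : 'I_q -> 'rV[R]_q -> R) z h (M : R) :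
  (forall y i, box z h y -> is_derive y (delta_mx 0 i) f (g i y)) ->
  (forall y i j, box z h y -> derivable (g i) y (delta_mx 0 j)) ->
  (forall y i j, box z h y -> `|'D_(delta_mx 0 j) (g i) y| <= M) ->
  `|f (z + h) - f z - \sum_(i < q) g i z * h 0 i|
    <= M * (\sum_(i < q) `|h 0 i|) ^+ 2.
Proof.
move=> df dg gM; set s := \sum_(i < q) `|h 0 i|.
have -> : M * s ^+ 2 = \sum_(i < q) M * s * `|h 0 i|.
  by rewrite -mulr_sumr -/s expr2 mulrA.
have E0 y i : box z h y -> derivable f y (delta_mx 0 i) by case/(df y i).
apply: (increment_le E0) => y i zhy.
have [_ ->] := df y i zhy.
have sub w : box z (y - z) w -> box z h w.
  by move=> wy k; apply: le_trans (wy k) (zhy k).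
have D1 w j : box z (y - z) w -> derivable (g i) w (delta_mx 0 j).
  by move=> /sub; exact: dg.
have D2 w j : box z (y - z) w -> `|'D_(delta_mx 0 j) (g i) w - 0| <= M.
  by move=> /sub; rewrite subr0; exact: gM.
have := @increment_le _ z (y - z) (fun=> 0) (fun=> M) D1 D2.
rewrite subrKC big1 ?subr0 => [|k _]; last by rewrite mul0r.
move=> /le_trans; apply; rewrite mulr_sumr; apply: ler_sum => k _.
have M0 : 0 <= M by apply: le_trans (gM y i i zhy).
by rewrite ler_wpM2l.
Qed.

End Taylor.

(** * Derivatives of vector-valued functions, and their measurability *)

Section ComponentDerivatives.
Context (R : realType).

Lemma is_derive_coord (V : normedModType R) (p : nat) (f : V -> 'rV[R]_p)
    (x v : V) (k : 'I_p) : derivable f x v ->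
  is_derive x v (fun y => f y 0 k) (('D_v f x) 0 k).
Proof.
move=> df; apply: DeriveDef; first by move/derivable_mxP: df => /(_ 0 k).
by rewrite derive_mx// mxE.
Qed.

Context (q p : nat).
Implicit Types (f : 'rV[R]_q -> 'rV[R]_p) (z h : 'rV[R]_q).

Lemma pderiv_le_deriv_norm l f z (s : l.-tuple 'I_q) k :
  `|pderiv s f z 0 k| <= deriv_norm l f z.
Proof.
apply: le_trans (coord_le_enorm _ _) _.
rewrite -[leLHS]ger0_norm ?enorm_ge0// -sqrtr_sqr ler_wsqrtr//.
by rewrite (bigD1 s)//= lerDl sumr_ge0// => ? _; exact: sqr_ge0.
Qed.

Lemma class_C_derivable n (U : set 'rV[R]_q) f z i :
  class_C n.+1 U f -> U z -> derivable f z (delta_mx 0 i).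
Proof. by move=> [df _]; exact: (df [::]). Qed.

(** The mean value theorem needs real values, hence one component at a time; [deriv_norm 2]
    dominates every entry of every second partial derivative. *)
Lemma class_C_taylor n (U : set 'rV[R]_q) f z h (M : R) k :
  class_C n.+2 U f -> box z h `<=` U ->
  (forall y, box z h y -> deriv_norm 2 f y <= M) ->
  `|f (z + h) 0 k - f z 0 k
     - \sum_(i < q) gradient (fun y => f y 0 k) z 0 i * h 0 i|
    <= M * (\sum_(i < q) `|h 0 i|) ^+ 2.
Proof.
move=> [df _] hU fM.
have zz : box z h z by move=> i; rewrite subrr mxE normr0.
have d1 y i : U y -> derivable f y (delta_mx 0 i) by exact: (df [::]).
have d2 y i j : U y -> derivable (pderiv [:: i] f) y (delta_mx 0 j).
  exact: (df [:: i]).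
under eq_bigr => i _.
  rewrite mxE (_ : 'D_(delta_mx 0 i) _ z = pderiv [:: i] f z 0 k); last first.
    by have [_ ->] := is_derive_coord k (d1 z i (hU _ zz)).
  over.
apply: (@taylor1_le R q (fun y => f y 0 k) (fun i y => pderiv [:: i] f y 0 k)).
- by move=> y i /hU Uy; exact/is_derive_coord/d1.
- by move=> y i j /hU Uy; case: (is_derive_coord k (d2 y i j Uy)).
- move=> y i j zhy; have [_ ->] := is_derive_coord k (d2 y i j (hU _ zhy)).
  exact: le_trans (pderiv_le_deriv_norm f y [tuple j; i] k) (fM y zhy).
Qed.

End ComponentDerivatives.

(** The derivative is a pointwise limit of a sequence of difference quotients, measurable because
    they sample [f] only at points of [U]. *)
Lemma measurable_derive (R : realType) (d : measure_display)
    (T : measurableType d) (D : set T) (V : normedModType R)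
    (f : T -> V -> R) (x v : V) (U : set V) :
  nbhs x U -> (forall y, U y -> measurable_fun D (f ^~ y)) ->
  (forall w, D w -> derivable (f w) x v) ->
  measurable_fun D (fun w => 'D_v (f w) x).
Proof.
move=> xU mf df.
have cv : h *: v + x @[h --> (0 : R)] --> x.
  rewrite -[X in _ --> X]add0r -[X in _ --> X + _](scale0r v).
  by apply: cvgD; [apply: cvgZ; [exact: cvg_id|exact: cvg_cst]|exact: cvg_cst].
have /nbhs_ballP[e /= e0 eU] := cv _ xU.
(* Here [e] is a radius for the scalar increment, not for points; the increments are nonzero and
   smaller than [e]. *)
pose h (m : nat) : R := e / 2 * m.+1%:R^-1.
have h0 m : h m != 0 by rewrite mulf_neq0// gt_eqF// divr_gt0.
have hU m : U (h m *: v + x).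
  apply: eU; rewrite /ball/= sub0r normrN ger0_norm ?mulr_ge0 ?ltW//.
  apply: (@le_lt_trans _ _ (e / 2)); last by lra.
  by rewrite ger_pMr ?divr_gt0// invf_le1// ler1n.
have hcvg : h m @[m --> \oo] --> 0.
  by rewrite -[X in _ --> X](mulr0 (e / 2)); apply: cvgM; [exact: cvg_cst|exact: cvg_harmonic].
apply: (@measurable_fun_cvg _ _ _ _
  (fun m w => (h m)^-1 * (f w (h m *: v + x) - f w x))).
  move=> m; apply: measurable_funM; first exact: measurable_cst.
  by apply: measurable_funB; apply: mf; [exact: hU|exact: nbhs_singleton].
move=> w Dw; pose g t := t^-1 * (f w (t *: v + x) - f w x).
have /cvgr_dnbhsP gl : g t @[t --> 0^'] --> 'D_v (f w) x by exact: (df w Dw).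
by apply: (gl h).
Qed.

(** * Suprema over open sets *)

Section RationalPoints.
Context (R : realType).

Lemma dense_rat_rV (q : nat) (O : set 'rV[R]_q) (v : 'rV[R]_q) :
  nbhs v O -> exists r : 'rV[rat]_q, O (map_mx ratr r).
Proof.
move=> /nbhs_ballP[e /= e0 eO].
have /choice[r rP] : forall i, exists r : rat, ball (v 0 i) e (ratr r : R).
  move=> i; have [|r] := @rat_in_itvoo R (v 0 i - e) (v 0 i + e); first by lra.
  rewrite in_itv/= => r_in; exists r.
  by rewrite /ball/= ltr_norml; apply/andP; split; lra.
exists (\row_i r i); apply: eO; split => // i j.
by rewrite ord1 !mxE; exact: rP.
Qed.

(** The index type is countable, so unions over these points preserve measurability. *)
Definition rat_pair (m n : nat) (x : 'rV[rat]_m * 'rV[rat]_n) :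
  'rV[R]_m * 'rV[R]_n := (map_mx ratr x.1, map_mx ratr x.2).

Lemma dense_rat_pair (m n : nat) (O : set ('rV[R]_m * 'rV[R]_n))
    (x : 'rV[R]_m * 'rV[R]_n) :
  nbhs x O -> exists r, O (rat_pair r).
Proof.
case: x => x y [[A B] /= [/dense_rat_rV[r Ar] /dense_rat_rV[s Bs]] AB].
by exists (r, s); exact: AB.
Qed.

End RationalPoints.

Section SupOverOpenSet.
Context (R : realType) (d : measure_display) (T : measurableType d) (m n : nat).
Variables (O : set ('rV[R]_m * 'rV[R]_n)) (F : T -> 'rV[R]_m * 'rV[R]_n -> R).
Hypothesis openO : open O.
Hypothesis contF : forall w x, O x -> {for x, continuous (F w)}.

(** By continuity the strict superlevel set in [O] is open, so being nonempty it contains a rational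
    point. *)
Lemma lt_esup_rat w (c : R) : (c%:E < esup O (F w))%E ->
  exists2 r, O (rat_pair R r) & c < F w (rat_pair R r).
Proof.
move=> /ereal_sup_gt[_ [x Ox <-]]; rewrite lte_fin => cF.
suff /dense_rat_pair[r [Or cr]] : nbhs x (O `&` [set y | c < F w y]) by exists r.
apply: filterI; first exact: open_nbhs_nbhs.
by have h : F w @ x --> F w x := contF Ox; exact: (h _ (lt_nbhsr cF)).
Qed.

Hypothesis measF : forall x, O x -> measurable_fun setT (F ^~ x).

(** The supremum reaches [c] exactly when, for every [k], some rational point has a value above
    [c - k.+1%:R^-1]. *)
Lemma measurable_le_esup (c : R) : measurable [set w | (c%:E <= esup O (F w))%E].
Proof.
pose G k r := [set w | O (rat_pair R r) /\ c - k.+1%:R^-1 < F w (rat_pair R r)].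
have mG k r : measurable (G k r).
  have [Or|nOr] := pselect (O (rat_pair R r)); last first.
    by rewrite (_ : G k r = set0)//; apply/seteqP; split => // w [].
  rewrite (_ : G k r = [set: T] `&`
      (F ^~ (rat_pair R r)) @^-1` `]c - k.+1%:R^-1, +oo[); last first.
    by rewrite setTI; apply/seteqP; split => [w [_ /=]|w /=];
      rewrite in_itv/= andbT.
  exact: measF.
rewrite (_ : mkset _ = \bigcap_k \bigcup_r G k r).
  apply: bigcapT_measurable => k; apply: countable_bigcupT_measurable => //.
apply/seteqP; split => w /=.
  move=> cF k _; have [|r Or cr] := @lt_esup_rat w (c - k.+1%:R^-1).
    by apply: lt_le_trans cF; rewrite lte_fin ltrBlDr ltrDl.
  by exists r.
move=> Gw; apply/lee_addgt0Pr => e e0.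
have [k ke] : exists k, k.+1%:R^-1 < e.
  by have [k _ /(_ k (leqnn k))] := near_infty_natSinv_lt (PosNum e0); exists k.
have [r _ [Or cr]] := Gw k I.
apply: (@le_trans _ _ ((F w (rat_pair R r))%:E + e%:E)%E).
  by rewrite -EFinD lee_fin -lerBlDr (le_trans _ (ltW cr))// lerB// ltW.
by rewrite leeD2r//; apply: ereal_sup_ubound; exists (rat_pair R r).
Qed.

End SupOverOpenSet.

(** This turns the two nested suprema of the event into one over an open set of pairs. *)
Lemma ereal_sup_esup (R : realType) (X Y : Type) (A : set X) (B : set Y)
    (f : X -> Y -> R) :
  ereal_sup [set esup B (f x) | x in A] =
  esup (A `*` B) (fun z => f z.1 z.2).
Proof.
apply/le_anti/andP; split; apply: ge_ereal_sup.
  move=> _ [x Ax <-]; apply: ge_ereal_sup => _ [y By <-].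
  by apply: ereal_sup_ubound; exists (x, y).
move=> _ [[x y] [/= Ax By] <-]; apply: le_ereal_sup_tmp.
exists (esup B (f x)); first by exists x.
by apply: ereal_sup_ubound; exists y.
Qed.

Lemma ae_forall_countType (d : measure_display) (T : measurableType d)
    (R : realType) (P : {measure set T -> \bar R}) (U : countType)
    (Q : U -> T -> Prop) :
  (forall u, {ae P, forall w, Q u w}) -> {ae P, forall w, forall u, Q u w}.
Proof.
move=> aeQ.
have : {ae P, forall w, forall k : nat,
    if unpickle k is Some u then Q u w else True}.
  apply: ae_foralln => k; case: unpickle => [u|]; first exact: aeQ.
  exact: aeW.
by apply: filterS => w Qw u; have := Qw (pickle u); rewrite pickleK.
Qed.

(** * The large deviation event *)

Lemma open_setX (X Y : topologicalType) (A : set X) (B : set Y) :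
  open A -> open B -> open (A `*` B).
Proof.
move=> oA oB; rewrite openE => -[x y] [/= Ax By].
by exists (A, B) => //; split; exact: open_nbhs_nbhs.
Qed.

Section LargeDeviationEvent.
Context (R : realType) (d : measure_display) (T : measurableType d)
  (pz pt p : nat) (Tz : set 'rV[R]_pz) (Tt : set 'rV[R]_pt) (z0 : 'rV[R]_pz)
  (b : nat -> R) (S : nat -> T -> 'rV[R]_pz * 'rV[R]_pt -> 'rV[R]_p).
Hypothesis openTz : open Tz.
Hypothesis openTt : open Tt.
Hypothesis Tz0 : Tz z0.
Hypothesis S_random : continuous_random_functions Tz Tt S.

(** The strict bound on [enorm u] makes this set open, as the passage to rational points
    requires. *)
Definition local_domain (n : nat) (r : R) : set ('rV[R]_pz * 'rV[R]_pt) :=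
  [set u | Tz (z0 + rate b n *: u) /\ r < enorm u] `*` Tt.

Lemma large_deviation_eventE n r : large_deviation_event Tz Tt z0 b S n r =
  [set w | ((expR (- r))%:E <=
    esup (local_domain n r) (fun x => Zfield z0 b S n w x.1 x.2))%E].
Proof. by apply/funext => w; rewrite /large_deviation_event/= ereal_sup_esup. Qed.

Lemma open_local_domain n r : open (local_domain n r).
Proof.
have c1 : continuous (fun u : 'rV[R]_pz => z0 + rate b n *: u).
  move=> u; apply: continuousD; first exact: cst_continuous.
  exact: scaler_continuous.
have o1 : open ((fun u : 'rV[R]_pz => z0 + rate b n *: u) @^-1` Tz).
  by apply: open_comp => // u _; exact: c1.
have o2 : open (@enorm R pz @^-1` [set x | r < x]).
  by apply: open_comp => [u _|]; [exact: continuous_enorm|exact: open_gt].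
exact: (open_setX (openI o1 o2) openTt).
Qed.

Lemma open_Theta : open (Theta Tz Tt). Proof. exact: open_setX. Qed.

(** The map [f] is arbitrary because [Zfield] evaluates [S] both at a point moving with [u] and at
    [z0]. *)
Lemma continuous_sqr_enorm_comp (X : topologicalType) n w
    (f : X -> 'rV[R]_pz * 'rV[R]_pt) x :
  Theta Tz Tt (f x) -> {for x, continuous f} ->
  {for x, continuous (fun y => enorm (S n w (f y)) ^+ 2)}.
Proof.
move=> fx cf; have [_ /(_ n w)] := S_random.
rewrite continuous_open_subspace; last exact: open_Theta.
move=> /(_ _ (mem_set fx)) cS.
apply: (@continuous_comp _ _ _ (fun y => enorm (S n w (f y))) (fun x => x ^+ 2));
  last exact: exprn_continuous.
apply: (@continuous_comp _ _ _ (fun y => S n w (f y)) (@enorm R p));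
  last exact: continuous_enorm.
exact: continuous_comp.
Qed.

Lemma continuous_Zfield n r w x : local_domain n r x ->
  {for x, continuous (fun x => Zfield z0 b S n w x.1 x.2)}.
Proof.
move=> [[Tx _] Ttx].
apply: (@continuous_comp _ _ _ (fun x : 'rV[R]_pz * 'rV[R]_pt =>
  Hfield b S n w (z0 + rate b n *: x.1) x.2 - Hfield b S n w z0 x.2) expR);
  last exact: continuous_expR.
have c1 : {for x, continuous (fun y : 'rV[R]_pz * 'rV[R]_pt =>
    (z0 + rate b n *: y.1, y.2))}.
  suff h : {for x, continuous (fun y : 'rV[R]_pz * 'rV[R]_pt =>
      z0 + rate b n *: y.1)} by exact: (cvg_pair h cvg_snd).
  apply: (@continuousD _ _ _ (fun=> z0) (fun y => rate b n *: y.1)).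
    exact: cst_continuous.
  apply: (@continuous_comp _ _ _ fst ( *:%R (rate b n))); first exact: cvg_fst.
  exact: scaler_continuous.
have c2 : {for x, continuous (fun y : 'rV[R]_pz * 'rV[R]_pt => (z0, y.2))}.
  have h : {for x, continuous (fun y : 'rV[R]_pz * 'rV[R]_pt => z0)}.
    exact: cst_continuous.
  exact: (cvg_pair h cvg_snd).
have sq f : Theta Tz Tt (f x) -> {for x, continuous f} -> {for x, continuous
    (fun y => - ((b n)^-1 * enorm (S n w (f y)) ^+ 2))}.
  move=> fx cf; apply: continuousN; apply: continuousM.
    exact: cst_continuous.
  exact: continuous_sqr_enorm_comp.
by apply: continuousB; [exact: (sq _ _ c1)|exact: (sq _ _ c2)].
Qed.

Lemma measurable_Hfield n z t : Theta Tz Tt (z, t) ->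
  measurable_fun setT (fun w => Hfield b S n w z t).
Proof.
move=> zt; apply: measurable_funN; apply: measurable_funM => //.
under eq_fun do rewrite sqr_enorm.
apply: measurable_sum => k; apply: measurable_funX.
by have [mS _] := S_random; exact: mS.
Qed.

Lemma measurable_Zfield n r x : local_domain n r x ->
  measurable_fun setT (fun w => Zfield z0 b S n w x.1 x.2).
Proof.
move=> [[Tx _] Ttx]; apply: measurableT_comp => //.
by apply: measurable_funB; exact: measurable_Hfield.
Qed.

Lemma measurable_large_deviation_event n r :
  measurable (large_deviation_event Tz Tt z0 b S n r).
Proof.
rewrite large_deviation_eventE; apply: measurable_le_esup.
- exact: open_local_domain.
- by move=> w x; exact: continuous_Zfield.
- by move=> x; exact: measurable_Zfield.
Qed.

(** The supremum may be attained only at irrational points or not at all. Relaxing [- r] to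
    [- (2 * r)] makes the inequality strict, so a rational point satisfies it. *)
Lemma large_deviation_event_rat n r w : 0 < r ->
  large_deviation_event Tz Tt z0 b S n r w ->
  exists2 x, local_domain n r (rat_pair R x) &
    let: (u, t) := rat_pair R x in
    - (2 * r) < Hfield b S n w (z0 + rate b n *: u) t - Hfield b S n w z0 t.
Proof.
move=> r0; rewrite large_deviation_eventE => Ew.
have lt_esup : ((expR (- (2 * r)))%:E <
    esup (local_domain n r) (fun x => Zfield z0 b S n w x.1 x.2))%E.
  by apply: lt_le_trans Ew; rewrite lte_fin ltr_expR; lra.
have [x Ox] := lt_esup_rat (@open_local_domain n r)
  (fun v y => @continuous_Zfield n r v y) lt_esup.
by rewrite ltr_expR; exists x.
Qed.

End LargeDeviationEvent.

(** * Union bounds, uniform moments and the deterministic lower bound *)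

Section UnionBound.
Context (R : realType) (d : measure_display) (T : measurableType d)
  (P : probability T R).

Lemma measure_bigsetU_le (I : Type) (s : seq I) (A : I -> set T) :
  (forall i, measurable (A i)) ->
  (P (\big[setU/set0]_(i <- s) A i) <= \sum_(i <- s) P (A i))%E.
Proof.
move=> mA; elim: s => [|i s IH]; first by rewrite !big_nil measure0.
rewrite !big_cons; apply: le_trans (leeD2l _ IH).
by apply: measureU2 => //; exact: bigsetU_measurable.
Qed.

(** [Q] does not depend on the outcome: it says that an index point lies in the domain, and [g] has
    to be measurable only in that case. *)
Lemma measurable_le_norm (D : set T) (Q : Prop) (g : T -> R) (c : R) :
  measurable D -> (Q -> measurable_fun D g) ->
  measurable [set w | [/\ D w, Q & c <= `|g w|]].
Proof.
move=> mD mg; have [q|nq] := pselect Q; last first.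
  by rewrite (_ : mkset _ = set0)//; apply/seteqP; split => // w [].
rewrite (_ : mkset _ = D `&` (Num.norm \o g) @^-1` `[c, +oo[).
  by apply: measurableT_comp => //; exact: mg.
by apply/seteqP; split => [w [Dw _ cw]|w [Dw /=]]; rewrite /= in_itv/= ?andbT.
Qed.

Lemma ereal_sup_range_bounded (f : nat -> \bar R) :
  (forall n, 0 <= f n)%E -> (ereal_sup (range f) < +oo)%E ->
  exists2 C : R, 0 <= C & forall n, (f n <= C%:E)%E.
Proof.
move=> f0 fy; exists (fine (ereal_sup (range f))).
  by rewrite fine_ge0// (le_trans (f0 0%N))// ereal_sup_ubound//; exists 0%N.
have f_ge0 : (0 <= ereal_sup (range f))%E.
  by rewrite (le_trans (f0 0%N))// ereal_sup_ubound//; exists 0%N.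
by move=> n; rewrite fineK ?ge0_fin_numE// ereal_sup_ubound//; exists n.
Qed.

Lemma integral_esup_ge0 (X : Type) (A : set X) (f : T -> X -> R) :
  A !=set0 -> (forall w x, 0 <= f w x) ->
  (0 <= \int[P]_w esup A (f w))%E.
Proof.
move=> [a Aa] f0; apply: integral_ge0 => w _; apply: le_ereal_sup_tmp.
by exists (f w a)%:E; [exists a|rewrite lee_fin].
Qed.

End UnionBound.

(* Here [x = a |u|] is the distance to the true value, [y] stands for
   [S_n / b_n], [y0] for [a_n S_n] at the true value, [s0] for the limit [S_0],
   [g] for the scaled gradient and [s1] for its limit.  Far from the true value
   [S_0] dominates, close to it the linear term does. *)
Lemma field_lower_bound (R : realFieldType) (p q : nat)
    (y y0 s0 : 'I_p -> R) (g s1 : 'I_p -> 'I_q -> R) (v : 'I_q -> R)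
    (beta a r x delta chi lambda eta : R) :
  0 < a -> beta * a ^+ 2 = 1 -> 0 < delta <= 1 ->
  p%:R * delta ^+ 2 < chi -> 2 * p%:R * delta ^+ 2 < lambda ->
  64 <= r * delta ^+ 2 -> r * a < x -> (forall i, `|v i| <= x) ->
  chi * x ^+ 2 <= \sum_(k < p) s0 k ^+ 2 ->
  lambda * x ^+ 2 <= 2 * \sum_(k < p) (\sum_(i < q) s1 k i * v i) ^+ 2 ->
  (eta <= x -> forall k, `|y k - s0 k| <= delta / 2 * x) ->
  (forall k, `|y0 k| <= delta / (8 * p.+1%:R) * r) ->
  (x < eta -> forall k,
     `|y k - a * y0 k - \sum_(i < q) g k i * v i| <= delta / 4 * x) ->
  (forall k i, `|g k i - s1 k i| <= delta / (4 * q.+1%:R)) ->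
  2 * r + \sum_(k < p) y0 k ^+ 2 <= beta * \sum_(k < p) y k ^+ 2.
Proof.
move=> a0 ba /andP[d0 d1] pchi plambda r64 rax vx s0x s1x far y0r near gs.
have d20 : 0 < delta ^+ 2 by exact: exprn_gt0.
have r0 : 0 < r by rewrite -(pmulr_lgt0 _ d20); lra.
have x0 : 0 < x by apply: le_lt_trans rax; rewrite mulr_ge0// ltW.
have b0 : 0 < beta by rewrite -(pmulr_lgt0 _ (exprn_gt0 2 a0)) ba.
have p1 : 1 <= p.+1%:R :> R by rewrite ler1n.
have q1 : 1 <= q.+1%:R :> R by rewrite ler1n.
(* The contrary makes every [y k] small compared with [x], which contradicts the bound from [chi]
   when [eta <= x] and the bound from [lambda] otherwise. *)
rewrite leNgt; apply/negP => yr.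
have c1 : delta / (8 * p.+1%:R) <= delta / 8.
  by rewrite ler_pM2l// lef_pV2 ?posrE; lra.
have y0d k : `|y0 k| <= delta / 8 * r.
  by apply: le_trans (y0r k) _; rewrite ler_wpM2r// ltW.
have y0s : \sum_(k < p) y0 k ^+ 2 <= delta ^+ 2 / 64 * r ^+ 2.
  apply: le_trans (sum_sqr_le y0r) _.
  have -> : p%:R * (delta / (8 * p.+1%:R) * r) ^+ 2 =
      delta ^+ 2 / 64 * r ^+ 2 * (p%:R / p.+1%:R ^+ 2).
    by field; rewrite gt_eqF//; lra.
  apply: ler_piMr.
    by apply: mulr_ge0; [apply: divr_ge0|exact: sqr_ge0] => //; exact: ltW.
  rewrite ler_pdivrMr ?exprn_gt0//.
  by rewrite mul1r -natrX ler_nat -mulnn (leq_trans (leqnSn p))// leq_pmulr.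
(* By [yr] and [y0s], [beta * y k ^+ 2] is below [2 * r + delta ^+ 2 / 64 * r ^+ 2], which is at
   most [(delta / 4 * r) ^+ 2] since [64 <= r * delta ^+ 2]. Multiplying by [a ^+ 2] turns [r] into
   [r * a < x]. *)
have yx k : `|y k| <= delta / 4 * x.
  have : beta * y k ^+ 2 <= (delta / 4 * r) ^+ 2.
    have : beta * y k ^+ 2 <= beta * \sum_(k < p) y k ^+ 2.
      rewrite ler_pM2l// (bigD1 k)//= lerDl sumr_ge0// => j _; exact: sqr_ge0.
    move=> /le_trans; apply; apply/ltW/(lt_le_trans yr).
    apply: le_trans (lerD (lexx _) y0s) _.
    suff : 64 * r <= r * delta ^+ 2 * r by nra.
    by rewrite ler_pM2r.
  move=> yk.
  rewrite -(@ler_pXn2r _ 2) ?nnegrE//; last by rewrite mulr_ge0//; lra.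
  rewrite real_normK ?num_real//.
  have : a ^+ 2 * (beta * y k ^+ 2) <= a ^+ 2 * (delta / 4 * r) ^+ 2.
    by rewrite ler_pM2l// exprn_gt0.
  rewrite mulrA (mulrC (a ^+ 2)) ba mul1r => /le_trans; apply.
  rewrite (_ : _ * _ = (delta / 4 * (r * a)) ^+ 2); last by ring.
  have ra0 : 0 < r * a by exact: mulr_gt0.
  by rewrite ler_pXn2r ?nnegrE ?mulr_ge0 ?ler_pM2l ?divr_gt0 ?invr_ge0 ?ltW.
have x20 : 0 < x ^+ 2 by exact: exprn_gt0.
have [ex|xe] := leP eta x.
  have s0d k : `|s0 k| <= delta * x.
    rewrite -[s0 k](subrK (y k)) (le_trans (ler_normD _ _))//.
    by rewrite distrC; move: (far ex k) (yx k); nra.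
  have := le_trans s0x (sum_sqr_le s0d).
  by rewrite exprMn (mulrA p%:R) ler_pM2r//; lra.
(* The errors in units of [delta * x] are 1/4 from [y k], 1/8 from [a * y0 k], 1/4 from the
   remainder and 1/4 from the gradient, in total 7/8. *)
have sd k : `|\sum_(i < q) s1 k i * v i| <= delta * x.
  have gv : `|\sum_(i < q) g k i * v i - \sum_(i < q) s1 k i * v i| <=
      delta / 4 * x.
    rewrite -sumrB (le_trans (ler_norm_sum _ _ _))//.
    apply: (@le_trans _ _ (\sum_(i < q) delta / (4 * q.+1%:R) * x)).
      by apply: ler_sum => i _; rewrite -mulrBl normrM ler_pM.
    rewrite sumr_const card_ord -[_ *+ q]mulr_natl.
    rewrite (_ : _ * _ = delta / 4 * x * (q%:R / q.+1%:R)); last first.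
      by field; rewrite gt_eqF//; lra.
    apply: ler_piMr; first by apply: mulr_ge0; lra.
    by rewrite ler_pdivrMr ?mul1r ?ler_nat.
  have ay : `|a * y0 k| <= delta / 8 * x.
    rewrite normrM gtr0_norm//; apply: (@le_trans _ _ (a * (delta / 8 * r))).
      by rewrite ler_pM2l.
    by rewrite mulrCA ler_pM2l ?(mulrC a) ?ltW//; lra.
  have := near xe k; move: gv ay (yx k); rewrite !ler_norml.
  set G := \sum_(i < q) g k i * v i; set s := \sum_(i < q) s1 k i * v i.
  by move=> /andP[? ?] /andP[? ?] /andP[? ?] /andP[? ?]; apply/andP; split; lra.
have := le_trans s1x _; move=> /(_ (2 * (p%:R * (delta * x) ^+ 2))).
rewrite ler_pM2l// => /(_ (sum_sqr_le sd)).
by rewrite exprMn (mulrA p%:R) (mulrA 2) ler_pM2r//; lra.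
Qed.

(** * Probabilities of the four deviations *)

Section Deviation.
Context (R : realType) (d : measure_display) (T : measurableType d)
  (P : probability T R) (pz pt p : nat)
  (Tz : set 'rV[R]_pz) (Tt : set 'rV[R]_pt) (z0 : 'rV[R]_pz)
  (b : nat -> R) (S : nat -> T -> 'rV[R]_pz * 'rV[R]_pt -> 'rV[R]_p).
Hypothesis openTz : open Tz.
Hypothesis openTt : open Tt.
Hypothesis Tz0 : Tz z0.
Hypothesis Tt0 : Tt !=set0.
Hypothesis S_random : continuous_random_functions Tz Tt S.

(** [D] will be the complement of a null set: the fields need not be differentiable elsewhere. *)
Lemma measurable_gradient n t k i (D : set T) : Tt t ->
  (forall w, D w -> class_C 3 Tz (fun z => S n w (z, t))) ->
  measurable_fun D (fun w => gradient (fun z => S n w (z, t) 0 k) z0 0 i).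
Proof.
move=> Ttt SC; under eq_fun do rewrite mxE.
apply: (@measurable_derive _ _ _ _ _ (fun w z => S n w (z, t) 0 k) _ _ Tz).
- exact: open_nbhs_nbhs.
- by move=> z Tzz; apply: (@measurable_funS _ _ _ _ setT) => //;
    have [mS _] := S_random; exact: mS.
- move=> w /SC/class_C_derivable/(_ Tz0) dS.
  by have [] := is_derive_coord k (dS i).
Qed.

Lemma rate_gt0 n : 0 < b n -> 0 < rate b n.
Proof. exact: powR_gt0. Qed.

Lemma rate_sqr n : 0 < b n -> b n * rate b n ^+ 2 = 1.
Proof.
move=> b0; rewrite /rate powRN powR12_sqrt ?ltW// exprVn sqr_sqrtr ?ltW//.
by rewrite mulfV ?gt_eqF.
Qed.

Variables (S0 : 'rV[R]_pz * 'rV[R]_pt -> 'rV[R]_p)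
  (dS0 : 'I_p -> 'rV[R]_pt -> 'rV[R]_pz)
  (chi lambda eps0 eps1 Delta rho delta M : R).
Hypothesis eps0_gt0 : 0 < eps0.
Hypothesis eps1_gt0 : 0 < eps1.
Hypothesis Delta_gt0 : 0 < Delta.
Hypothesis M_gt0 : 0 < M.
Hypothesis delta01 : 0 < delta <= 1.
Hypothesis delta_chi : p%:R * delta ^+ 2 < chi.
Hypothesis delta_lambda : 2 * p%:R * delta ^+ 2 < lambda.
Hypothesis Tz_Delta : forall z, Tz z -> enorm (z - z0) <= Delta.
Hypothesis Tz_rho : forall z, (forall i, `|(z - z0) 0 i| < rho) -> Tz z.
Hypothesis S0_ge : forall z t, Theta Tz Tt (z, t) ->
  chi * enorm (z - z0) ^+ 2 <= enorm (S0 (z, t)) ^+ 2.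
Hypothesis dS0_ge : forall t v, Tt t -> lambda * enorm v ^+ 2 <=
  2 * \sum_(k < p) (\sum_(i < pz) dS0 k t 0 i * v 0 i) ^+ 2.

(* The exponents are chosen so that each deviation below has probability
   [O(r^-M)] by Markov's inequality. *)
Lemma deviation_probability_le n r (C0 C1 C2 : R) (C3 : 'I_p -> R)
    (c0 := delta / 2 / (Delta ^+ 2) `^ eps0)
    (c1 := delta / (8 * p.+1%:R))
    (c2 := delta / 4 / pz.+1%:R ^+ 2)
    (c3 := delta / (4 * pz.+1%:R) / (Delta ^+ 2) `^ eps1) :
  0 < b n ->
  (forall t, Tt t -> {ae P, forall w, class_C 3 Tz (fun z => S n w (z, t))}) ->
  64 <= r * delta ^+ 2 -> r `^ (- eps0) <= rho ->
  (\int[P]_w esup (Theta Tz Tt) (fun th => (enorm (b n `^ eps0 *: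
     ((b n)^-1 *: S n w th - S0 th)) `^ (M / eps0))%R) <= C0%:E)%E ->
  (\int[P]_w esup Tt (fun t => (enorm (rate b n *: S n w (z0, t)) `^ M)%R)
     <= C1%:E)%E ->
  (\int[P]_w esup (Theta Tz Tt) (fun th => (((b n)^-1 *
     deriv_norm 2 (fun z => S n w (z, th.2)) th.1) `^ (M / eps0))%R)
     <= C2%:E)%E ->
  (forall k, \int[P]_w esup Tt (fun t => (enorm (b n `^ eps1 *:
     ((b n)^-1 *: gradient (fun z => S n w (z, t) 0 k : R) z0 - dS0 k t))
     `^ (M / (2 * eps1)))%R) <= (C3 k)%:E)%E ->
  (P (large_deviation_event Tz Tt z0 b S n r) <=
    ((C0 / c0 `^ (M / eps0) + C1 / c1 `^ M + C2 / c2 `^ (M / eps0)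
      + \sum_(k < p) C3 k / c3 `^ (M / (2 * eps1))) / r `^ M)%:E)%E.
Proof.
move=> bn0 SC r64 r_rho int0 int1 int2 int3.
have [d0 d1] := andP delta01.
have r0 : 0 < r by rewrite -(pmulr_lgt0 _ (exprn_gt0 2 d0)); lra.
set beta := b n; set a := rate b n; set eta := r `^ (- eps0).
have a0 : 0 < a := rate_gt0 bn0.
have ba : beta * a ^+ 2 = 1 := rate_sqr bn0.
have q0 : 0 < pz.+1%:R :> R by rewrite ltr0n.
have q1 : 0 < p.+1%:R :> R by rewrite ltr0n.
have De0 e : 0 < (Delta ^+ 2) `^ e by rewrite powR_gt0// exprn_gt0.
have c0_gt0 : 0 < c0 by rewrite !divr_gt0.
have c1_gt0 : 0 < c1 by rewrite divr_gt0// mulr_gt0.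
have c2_gt0 : 0 < c2 by rewrite !divr_gt0// exprn_gt0.
have c3_gt0 : 0 < c3 by rewrite !divr_gt0// mulr_gt0.
have bV0 : 0 < beta^-1 by rewrite invr_gt0.
have be0 e : 0 < beta `^ e by exact: powR_gt0.
(* outside the null set [N] the fields are smooth at all rational [t] *)
have [N [mN PN0 NC]] : {ae P, forall w, forall q : 'rV[rat]_pt,
    Tt (map_mx ratr q) -> class_C 3 Tz (fun z => S n w (z, map_mx ratr q))}.
  apply: ae_forall_countType => q; have [Tq|nTq] := pselect (Tt (map_mx ratr q)).
    by apply: filterS (SC _ Tq).
  exact: aeW.
have smooth w q : (~` N) w -> Tt (map_mx ratr q) ->
    class_C 3 Tz (fun z => S n w (z, map_mx ratr q)).
  move=> nNw; apply: contrapT => /not_implyP[Tq nC]; apply: nNw; apply: NC => /=.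
  by move=> /(_ q Tq).
have mNC : measurable (~` N) by exact: measurableC.
pose u (x : 'rV[rat]_pz * 'rV[rat]_pt) : 'rV[R]_pz := map_mx ratr x.1.
pose t (x : 'rV[rat]_pz * 'rV[rat]_pt) : 'rV[R]_pt := map_mx ratr x.2.
pose v x := a *: u x.
pose dom x := local_domain Tz Tt z0 b n r (u x, t x).
have domTheta x : dom x -> Theta Tz Tt (z0 + v x, t x) by case=> -[].
have dom0 x : dom x -> Theta Tz Tt (z0, t x) by case.
have dom_v x : dom x -> r * a < enorm (v x) <= Delta.
  move=> [[/= Tzx ru] _]; apply/andP; split.
    by rewrite enormZ gtr0_norm// mulrC ltr_pM2l.
  by have := Tz_Delta Tzx; rewrite addrC addKr.
(* A nonempty domain forces [r * a < Delta], that is [r ^+ 2 < Delta ^+ 2 * beta]; powers of [beta]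
   thus dominate powers of [r]. *)
have pow_le x e : 0 <= e -> dom x ->
    (r ^+ 2) `^ e <= (Delta ^+ 2) `^ e * beta `^ e.
  move=> e0 /dom_v/andP[rav vD].
  rewrite -powRM ?sqr_ge0 ?(ltW bn0)//.
  apply: ge0_ler_powR; rewrite ?nnegrE ?sqr_ge0//.
    by rewrite mulr_ge0 ?sqr_ge0// ltW.
  rewrite -[leLHS]mul1r -ba [leLHS](_ : _ = (r * a) ^+ 2 * beta); last by ring.
  have ra0 : 0 < r * a by exact: mulr_gt0.
  rewrite ler_pM2r// ler_pXn2r ?nnegrE ?(ltW ra0) ?(ltW Delta_gt0)//.
  exact/ltW/(lt_le_trans rav vD).
pose X0 x k w := beta `^ eps0 * (beta^-1 * S n w (z0 + v x, t x) 0 k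
  - S0 (z0 + v x, t x) 0 k).
pose X1 x k w := a * S n w (z0, t x) 0 k.
pose grad x k i w := gradient (fun z => S n w (z, t x) 0 k) z0 0 i.
pose X2 x k w := beta^-1 * (S n w (z0 + v x, t x) 0 k - S n w (z0, t x) 0 k
  - \sum_(i < pz) grad x k i w * v x 0 i).
pose X3 x k i w := beta `^ eps1 * (beta^-1 * grad x k i w - dS0 k (t x) 0 i).
pose A0 := \bigcup_(y : ('rV[rat]_pz * 'rV[rat]_pt) * 'I_p)
  [set w | [/\ setT w, dom y.1 & c0 * r `^ eps0 <= `|X0 y.1 y.2 w|]].
pose A1 := \bigcup_(y : ('rV[rat]_pz * 'rV[rat]_pt) * 'I_p)
  [set w | [/\ setT w, dom y.1 & c1 * r <= `|X1 y.1 y.2 w|]].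
(* The event is stated through the Taylor remainder at rational points, which is measurable, and not
   through a supremum of second derivatives. *)
pose A2 := \bigcup_(y : ('rV[rat]_pz * 'rV[rat]_pt) * 'I_p)
  [set w | [/\ (~` N) w, dom y.1 /\ enorm (v y.1) < eta &
    delta / 4 * enorm (v y.1) <= `|X2 y.1 y.2 w|]].
pose A3 k := \bigcup_(y : ('rV[rat]_pz * 'rV[rat]_pt) * 'I_pz)
  [set w | [/\ (~` N) w, dom y.1 & c3 * (r ^+ 2) `^ eps1 <= `|X3 y.1 k y.2 w|]].
have mS x k : Theta Tz Tt x -> measurable_fun setT (fun w => S n w x 0 k).
  by have [mS _] := S_random; exact: mS.
have mgrad x k i : dom x -> measurable_fun (~` N) (grad x k i).
  by move=> [_ Tx]; apply: measurable_gradient => // w nN; exact: smooth.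
have mA0 : measurable A0.
  apply: countable_bigcupT_measurable => // -[x k] /=.
  apply: (@measurable_le_norm _ _ _ setT) => // /domTheta dx.
  apply: measurable_funM => //; apply: measurable_funB => //.
  by apply: measurable_funM => //; exact: mS.
have mA1 : measurable A1.
  apply: countable_bigcupT_measurable => // -[x k] /=.
  apply: (@measurable_le_norm _ _ _ setT) => // /dom0 dx.
  by apply: measurable_funM => //; exact: mS.
have mA2 : measurable A2.
  apply: countable_bigcupT_measurable => // -[x k] /=.
  apply: measurable_le_norm => // -[dx _].
  apply: measurable_funM => //; apply: measurable_funB.
    by apply: measurable_funTS; apply: measurable_funB; apply: mS;
      [exact: domTheta|exact: dom0].
  apply: measurable_sum => i; apply: measurable_funM => //.
  exact: mgrad.
have mA3 k : measurable (A3 k).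
  apply: countable_bigcupT_measurable => // -[x i] /=.
  apply: measurable_le_norm => // dx.
  apply: measurable_funM => //; apply: measurable_funB => //.
  by apply: measurable_funM => //; exact: mgrad.
(* A threshold of order [e] in [r], raised to the moment [M / e], yields the decay of order [M]. *)
have powE C c e : 0 < c -> 0 < e ->
    C / c `^ (M / e) / r `^ M = C / (c * r `^ e) `^ (M / e).
  move=> cgt0 e0; rewrite powRM ?powR_ge0 ?(ltW cgt0)// -powRrM mulrCA.
  by rewrite divff ?gt_eqF// mulr1 invfM mulrA.
have Me0 e : 0 < e -> 0 <= M / e by move=> e0; rewrite divr_ge0 ?ltW.
have re0 e : 0 < r `^ e by exact: powR_gt0.
have Th0 : Theta Tz Tt !=set0 by have [s Tts] := Tt0; exists (z0, s).
have P0 : (P A0 <= (C0 / c0 `^ (M / eps0) / r `^ M)%:E)%E.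
  rewrite powE//; apply: (integral_esup_tail Th0 (Me0 _ eps0_gt0) _ int0 mA0).
    exact: mulr_gt0.
  move=> w [[x k] _ [_ /= dx /le_trans X0w]]; exists (z0 + v x, t x).
    exact: domTheta.
  by apply: X0w; apply: le_trans (coord_le_enorm _ k); rewrite !mxE.
have P1 : (P A1 <= (C1 / c1 `^ M / r `^ M)%:E)%E.
  have := @powE C1 c1 1 c1_gt0 ltr01.
  rewrite divr1 powRr1 ?(ltW r0)// => ->.
  apply: (integral_esup_tail Tt0 (ltW M_gt0) _ int1 mA1); first exact: mulr_gt0.
  move=> w [[x k] _ [_ /= [_ Ttx] /le_trans X1w]]; exists (t x) => //.
  by apply: X1w; apply: le_trans (coord_le_enorm _ k); rewrite !mxE.
have P2 : (P A2 <= (C2 / c2 `^ (M / eps0) / r `^ M)%:E)%E.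
  rewrite powE//; apply: (integral_esup_tail Th0 (Me0 _ eps0_gt0) _ int2 mA2).
    exact: mulr_gt0.
  move=> w [[x k] _ [nNw /= [dx vx] X2w]].
  have [/andP[rav _] [_ Ttx]] := (dom_v _ dx, dx).
  have v0 : 0 < enorm (v x) by apply: le_lt_trans rav; rewrite mulr_ge0 ?ltW.
  have sub : box z0 (v x) `<=` Tz.
    move=> z zv; apply: Tz_rho => i; apply: le_lt_trans (zv i) _.
    exact: le_lt_trans (coord_le_enorm _ _) (lt_le_trans vx r_rho).
  (* If the second derivatives were below the threshold on the whole box, the Taylor bound would
     make the remainder too small. The point so obtained need not be rational, which the tail bound
     allows. *)
  apply: contrapT => nex; move: X2w; apply/negP; rewrite -ltNge.
  pose m := c2 * r `^ eps0.
  have dm z : box z0 (v x) z ->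
      deriv_norm 2 (fun z => S n w (z, t x)) z <= beta * m.
    move=> zv; rewrite leNgt; apply/negP => mz; apply: nex.
    exists (z, t x); first by split => //; exact: sub.
    by rewrite /= ler_pdivlMl// ltW.
  have := class_C_taylor k (smooth w _ nNw Ttx) sub dm.
  rewrite -[leLHS]/(`|_|) /X2 normrM (gtr0_norm bV0) => taylor.
  rewrite mulrC ltr_pdivrMr//; apply: (le_lt_trans taylor).
  have sv : \sum_(i < pz) `|v x 0 i| <= pz%:R * enorm (v x).
    rewrite -[pz in pz%:R]card_ord mulr_natl -sumr_const.
    by apply: ler_sum => i _; exact: coord_le_enorm.
  (* As [enorm (v x) < eta], one of the two factors [enorm (v x)] of the quadratic remainder absorbs
     the power of [r]; the square in [c2] pays for passing from the sum of absolute coordinates to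
     [enorm]. *)
  have rx : r `^ eps0 * enorm (v x) < 1.
    have -> : 1 = r `^ eps0 * eta by rewrite /eta powRN mulfV// gt_eqF.
    by rewrite ltr_pM2l.
  rewrite [ltRHS]mulrC -mulrA ltr_pM2l//.
  apply: (@le_lt_trans _ _ (m * (pz.+1%:R * enorm (v x)) ^+ 2)).
    rewrite ler_pM2l ?mulr_gt0// ler_pXn2r ?nnegrE ?sumr_ge0//.
      by rewrite (le_trans sv)// ler_pM2r// ler_nat.
    by rewrite mulr_ge0// ltW.
  have -> : m * (pz.+1%:R * enorm (v x)) ^+ 2 =
      delta / 4 * enorm (v x) * (r `^ eps0 * enorm (v x)).
    by rewrite /m /c2; field; rewrite gt_eqF.
  by rewrite -[ltRHS]mulr1 ltr_pM2l// mulr_gt0// divr_gt0.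
have P3 k : (P (A3 k) <= (C3 k / c3 `^ (M / (2 * eps1)) / r `^ M)%:E)%E.
  rewrite powE//; last by rewrite mulr_gt0.
  apply: (integral_esup_tail Tt0 _ _ (int3 k) (mA3 k)).
  - by rewrite Me0// mulr_gt0.
  - exact: mulr_gt0.
  move=> w [[x i] _ [_ /= [_ Ttx] /le_trans X3w]]; exists (t x) => //.
  rewrite powRrM powR_mulrn ?(ltW r0)//.
  by apply: X3w; apply: le_trans (coord_le_enorm _ i); rewrite /X3 /grad !mxE.
(* Outside these sets, [field_lower_bound] at the rational point given by the event contradicts the
   inequality satisfied there. *)
have cover : large_deviation_event Tz Tt z0 b S n r `<=`
    N `|` (A0 `|` (A1 `|` (A2 `|` \big[setU/set0]_(k < p) A3 k))).
  move=> w Ew; apply: contrapT => /not_orP[nN /not_orP[n0]].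
  move=> /not_orP[n1 /not_orP[n2 n3]].
  have [x dx] := large_deviation_event_rat openTz openTt Tz0 S_random r0 Ew.
  rewrite /rat_pair /= -/(u x) -/(t x) -/a -/(v x) in dx *.
  rewrite -/(dom x) in dx.
  have /andP[rav vD] := dom_v _ dx.
  have [_ Ttx] := dx.
  have v0 : 0 < enorm (v x) by apply: le_lt_trans rav; rewrite mulr_ge0 ?ltW.
  apply/negP; rewrite -leNgt.
  have := @field_lower_bound R p pz (fun k => beta^-1 * S n w (z0 + v x, t x) 0 k)
    (fun k => a * S n w (z0, t x) 0 k) (fun k => S0 (z0 + v x, t x) 0 k)
    (fun k i => beta^-1 * grad x k i w) (fun k i => dS0 k (t x) 0 i)
    (fun i => v x 0 i) beta a r (enorm (v x)) delta chi lambda eta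
    a0 ba delta01 delta_chi delta_lambda r64 rav (coord_le_enorm (v x)).
  have aa : a * a = beta^-1.
    by apply: (mulfI (lt0r_neq0 bn0)); rewrite -expr2 mulfV ?gt_eqF.
  have -> : \sum_(k < p) (a * S n w (z0, t x) 0 k) ^+ 2 =
      beta^-1 * enorm (S n w (z0, t x)) ^+ 2.
    rewrite sqr_enorm mulr_sumr -aa.
    by apply: eq_bigr => j _; rewrite exprMn expr2.
  have -> : beta * \sum_(k < p) (beta^-1 * S n w (z0 + v x, t x) 0 k) ^+ 2 =
      beta^-1 * enorm (S n w (z0 + v x, t x)) ^+ 2.
    rewrite sqr_enorm !mulr_sumr; apply: eq_bigr => j _.
    by rewrite exprMn; field; rewrite gt_eqF.
  move=> lower; rewrite /Hfield -/beta.
  suff : 2 * r + beta^-1 * enorm (S n w (z0, t x)) ^+ 2 <=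
    beta^-1 * enorm (S n w (z0 + v x, t x)) ^+ 2 by lra.
  apply: lower.
  - have := S0_ge (domTheta _ dx).
    by rewrite addrAC subrr add0r -sqr_enorm.
  - exact: dS0_ge.
  - move=> eta_v k; rewrite leNgt; apply/negP => dev; apply: n0.
    exists (x, k) => //; split => //=; rewrite /X0 normrM (gtr0_norm (be0 _)).
    apply: (@le_trans _ _ (beta `^ eps0 * (delta / 2 * enorm (v x)))); last first.
      by rewrite ler_pM2l// ltW.
    (* One factor is bounded by [pow_le], which is the origin of the power of [Delta] in [c0], and
       the other by [eta <= enorm (v x)]. *)
    have -> : r `^ eps0 = (r ^+ 2) `^ eps0 * eta.
      rewrite -powR_mulrn ?(ltW r0)// -powRrM /eta -powRD; last first.
        by apply/implyP => _; rewrite gt_eqF.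
      by congr (_ `^ _); ring.
    apply: (@le_trans _ _
      (c0 * ((Delta ^+ 2) `^ eps0 * beta `^ eps0 * enorm (v x)))).
      rewrite ler_pM2l// ler_pM ?powR_ge0//.
      by apply: (pow_le x); rewrite ?ltW.
    rewrite le_eqVlt; apply/orP; left; apply/eqP.
    by rewrite /c0; field; rewrite gt_eqF.
  - move=> k; rewrite leNgt; apply/negP => /ltW dev; apply: n1.
    by exists (x, k).
  - move=> v_eta k; rewrite leNgt; apply/negP => /ltW dev; apply: n2.
    exists (x, k) => //; split => //=; apply: le_trans dev _.
    rewrite le_eqVlt; apply/orP; left; apply/eqP; congr (`|_|).
    rewrite /X2 !mulrBr mulrA aa mulr_sumr; congr (_ - _).
    by apply: eq_bigr => i _; rewrite mulrA.
  - move=> k i; rewrite leNgt; apply/negP => dev; apply: n3.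
    rewrite (bigD1 k)//=; left; exists (x, i) => //; split => //=.
    rewrite /X3 normrM (gtr0_norm (be0 _)).
    apply: (@le_trans _ _ (beta `^ eps1 * (delta / (4 * pz.+1%:R)))); last first.
      by rewrite ler_pM2l// ltW.
    apply: (@le_trans _ _ (c3 * ((Delta ^+ 2) `^ eps1 * beta `^ eps1))).
      by rewrite ler_pM2l//; apply: (pow_le x); rewrite ?ltW.
    rewrite le_eqVlt; apply/orP; left; apply/eqP.
    by rewrite /c3; field; rewrite !gt_eqF.
have mE := measurable_large_deviation_event b openTz openTt Tz0 S_random n r.
have mB : measurable (\big[setU/set0]_(k < p) A3 k).
  exact: bigsetU_measurable.
have m2 := measurableU _ _ mA2 mB; have m1 := measurableU _ _ mA1 m2.
have m0 := measurableU _ _ mA0 m1; have mN' := measurableU _ _ mN m0.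
apply: le_trans (le_measure P (mem_set mE) (mem_set mN') cover) _.
apply: le_trans (measureU2 _ mN m0) _.
rewrite [X in (X + _)%E](_ : _ = 0%E) ?add0e; last exact: PN0.
apply: le_trans (measureU2 _ mA0 m1) _.
apply: le_trans (leeD P0 (measureU2 _ mA1 m2)) _.
apply: le_trans (leeD2l _ (leeD P1 (measureU2 _ mA2 mB))) _.
apply: le_trans (leeD2l _ (leeD2l _ (leeD P2
  (measure_bigsetU_le P (index_enum _) mA3)))) _.
apply: le_trans (leeD2l _ (leeD2l _ (leeD2l _ (lee_sum _ (fun k _ => P3 k))))) _.
by rewrite sumEFin -!EFinD lee_fin -mulr_suml -!mulrDl !addrA.
Qed.

End Deviation.

(** * The matrix [Gamma0], the choice of constants and the final bound *)

Lemma quadratic_form_Gamma0 (R : realType) (pz pt p : nat)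
    (dS0 : 'I_p -> 'rV[R]_pt -> 'rV[R]_pz) (t : 'rV[R]_pt) (v : 'rV[R]_pz) :
  (v *m Gamma0 dS0 t *m v^T) 0 0 =
  2 * \sum_(k < p) (\sum_(i < pz) dS0 k t 0 i * v 0 i) ^+ 2.
Proof.
rewrite /Gamma0 -scalemxAr -scalemxAl mxE mulmx_sumr mulmx_suml summxE.
congr (_ * _); apply: eq_bigr => k _.
have -> : v *m tensor2 (dS0 k t) *m v^T = (dS0 k t *m v^T)^T *m (dS0 k t *m v^T).
  by rewrite trmx_mul trmxK /tensor2 !mulmxA.
rewrite mxE big_ord1 [X in X * _]mxE -expr2 mxE.
by congr (_ ^+ 2); apply: eq_bigr => i _; rewrite mxE.
Qed.

Lemma trmx_Gamma0 (R : realType) (pz pt p : nat)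
    (dS0 : 'I_p -> 'rV[R]_pt -> 'rV[R]_pz) (t : 'rV[R]_pt) :
  (Gamma0 dS0 t)^T = Gamma0 dS0 t.
Proof.
rewrite /Gamma0 linearZ/= raddf_sum/=; congr (_ *: _).
by apply: eq_bigr => k _; rewrite /tensor2 trmx_mul trmxK.
Qed.

Lemma bounded_set_enorm (R : realType) (q : nat) (U : set 'rV[R]_q)
    (z0 : 'rV[R]_q) : bounded_set U -> U z0 ->
  exists2 Delta, 0 < Delta & forall z, U z -> enorm (z - z0) <= Delta.
Proof.
(* Boundedness provides a bound only for numbers strictly above [B], and [B] may be negative. Below,
   [q.+1] keeps the radius positive when [q = 0]. *)
move=> [B [_ UB]] Uz0; pose B1 := Num.max B 0 + 1.
have B1_gt0 : 0 < B1 by rewrite ltr_wpDl// le_max lexx orbT.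
have coordB z i : U z -> `|z 0 i| <= B1.
  have BB1 : B < B1.
    by apply: (@le_lt_trans _ _ (Num.max B 0)); rewrite ?ltrDl// le_max lexx.
  move=> /(UB _ BB1); apply: le_trans; rewrite {2}/Num.norm /= mx_normrE.
  exact: (le_bigmax _ (fun ij : 'I_1 * 'I_q => `|z ij.1 ij.2|) (0, i)).
have q0 : 0 < q.+1%:R :> R by rewrite ltr0n.
have Delta0 : 0 < q.+1%:R * (2 * B1) by rewrite !mulr_gt0.
exists (q.+1%:R * (2 * B1)) => // z Uz.
rewrite -(@ler_pXn2r _ 2) ?nnegrE ?enorm_ge0 ?(ltW Delta0)//.
have zz0 i : `|(z - z0) 0 i| <= 2 * B1.
  rewrite !mxE (le_trans (ler_normB _ _))//.
  by have := coordB z i Uz; have := coordB z0 i Uz0; lra.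
apply: le_trans (sqr_enorm_le zz0) _; rewrite [leRHS]exprMn ler_pM2r.
  by rewrite -natrX ler_nat -mulnn (leq_trans (leqnSn q))// leq_pmulr.
by rewrite exprn_gt0// mulr_gt0.
Qed.

Lemma small_delta (R : realFieldType) (p : nat) (chi lambda : R) :
  0 < chi -> 0 < lambda ->
  exists delta, [/\ 0 < delta <= 1, p%:R * delta ^+ 2 < chi
    & 2 * p%:R * delta ^+ 2 < lambda].
Proof.
move=> chi0 lambda0; pose m := Num.min chi lambda.
have m0 : 0 < m by rewrite lt_min chi0.
have p0 : 0 <= p%:R :> R by [].
have p1 : 0 < 2 * p%:R + 1 :> R by lra.
have [mc ml] : m <= chi /\ m <= lambda by rewrite !ge_min !lexx orbT.
(* Since [delta <= 1], its square is at most [delta], and [(2 * p%:R + 1) * delta <= m] leaves room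
   for strict inequalities. *)
pose delta := Num.min 1 (m / (2 * p%:R + 1)).
have d0 : 0 < delta by rewrite lt_min ltr01 divr_gt0.
have [d1 dm] : delta <= 1 /\ delta <= m / (2 * p%:R + 1).
  by rewrite !ge_min !lexx orbT.
have dd : delta ^+ 2 <= delta by rewrite expr2 ler_piMr// ltW.
have pm : (2 * p%:R + 1) * delta <= m by rewrite mulrC -ler_pdivlMr.
exists delta; rewrite d0 d1; split => //.
  by have := ler_wpM2l p0 dd; nra.
by have := ler_wpM2l p0 dd; nra.
Qed.

Theorem theorem4p4 (R : realType) (d : measure_display) (T : measurableType d)
    (P : probability T R) (pz pt p : nat)
    (Tz : set 'rV[R]_pz) (Tt : set 'rV[R]_pt)
    (z0 : 'rV[R]_pz) (t0 : 'rV[R]_pt)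
    (b : nat -> R) (S : nat -> T -> 'rV[R]_pz * 'rV[R]_pt -> 'rV[R]_p)
    (Tz_domain : bounded_convex_domain Tz)
    (Tt_domain : bounded_convex_domain Tt)
    (theta0_in : Theta Tz Tt (z0, t0))
    (b_gt0 : forall n, 0 < b n)
    (b_cvg : b n @[n --> \oo] --> +oo)
    (S_random : continuous_random_functions Tz Tt S)
    (S_smooth : smoothness P Tz Tt S)
    (S_moments : bounded_moments P Tz Tt z0 b S)
    (S_limit : limit_of_S P Tz Tt z0 b S)
    (S_gradient_limit : limit_of_gradient P Tt z0 b S) :
  polynomial_large_deviation P Tz Tt z0 b S.
Proof.
have [_ openTz _ boundedTz] := Tz_domain; have [Tt_ne openTt _ _] := Tt_domain.
have [/= Tz0 _] := theta0_in.
have Th_ne : Theta Tz Tt !=set0 by exists (z0, t0).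
have [S0 [chi [eps0 [[chi_gt0 eps0_gt0] _ _ S0_ge S0_moments]]]] := S_limit.
have [dS0 [eps1 [eps1_gt0 _ [lambda lambda_gt0 lambda_le] dS0_moments]]] :=
  S_gradient_limit.
have dS0_ge t v : Tt t -> lambda * enorm v ^+ 2 <=
    2 * \sum_(k < p) (\sum_(i < pz) dS0 k t 0 i * v 0 i) ^+ 2.
  move=> /subset_closure/lambda_le lt; rewrite -quadratic_form_Gamma0.
  apply: le_trans (min_eigenvalue_le _ (trmx_Gamma0 _ _)).
  by rewrite ler_wpM2r// sqr_ge0.
have [Delta Delta_gt0 Tz_Delta] := bounded_set_enorm boundedTz Tz0.
(* Balls of the library norm are cubes, hence the coordinatewise form. *)
have [rho /= rho_gt0 Tz_rho] : exists2 rho : R, 0 < rho &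
    forall z : 'rV[R]_pz, (forall i, `|(z - z0) 0 i| < rho) -> Tz z.
  have /nbhs_ballP[rho /= rho_gt0 rhoTz] : nbhs z0 Tz by exact: open_nbhs_nbhs.
  exists rho => // z zrho; apply: rhoTz; split => // i j.
  by rewrite /ball/= ord1 distrC; have := zrho j; rewrite !mxE.
have [delta [delta01 delta_chi delta_lambda]] :=
  small_delta p chi_gt0 lambda_gt0.
have [d0 _] := andP delta01.
move=> M M_gt0.
have Me e : 0 < e -> 0 < M / e by move=> e_gt0; rewrite divr_gt0.
have moment_ge0 K n l : (0 <= \int[P]_w esup (Theta Tz Tt) (fun th =>
    (((b n)^-1 * deriv_norm l (fun z => S n w (z, th.2)) th.1) `^ K)%R))%E.
  by apply: integral_esup_ge0 => // w x; exact: powR_ge0.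
have moment0_ge0 K n : (0 <= \int[P]_w esup Tt (fun t =>
    (enorm (rate b n *: S n w (z0, t)) `^ K)%R))%E.
  by apply: integral_esup_ge0 => // w x; exact: powR_ge0.
have sup_ge0 (f : nat -> \bar R) :
    (forall n, 0 <= f n)%E -> (0 <= ereal_sup (range f))%E.
  by move=> f0; apply: le_trans (f0 0%N) _; apply: ereal_sup_ubound; exists 0%N.
have [C0 C0_ge0 int0] := ereal_sup_range_bounded
  (fun n => integral_esup_ge0 P Th_ne (fun w x => powR_ge0 _ _))
  (S0_moments _ (Me _ eps0_gt0)).
have [C1 C1_ge0 int1] : exists2 C, 0 <= C & forall n, (\int[P]_w esup Tt (fun t =>
    (enorm (rate b n *: S n w (z0, t)) `^ M)%R) <= C%:E)%E.
  apply: (ereal_sup_range_bounded (moment0_ge0 M)).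
  (* One summand is bounded by the sum because the other is nonnegative; as the maximum starts from
     [-oo], this is seen on its term of order 0. *)
  apply: le_lt_trans (S_moments M M_gt0); rewrite leeDl//.
  apply: le_trans (le_bigmax _ _ (Ordinal (isT : (0 < 4)%N))).
  by apply: sup_ge0 => n; exact: moment_ge0.
have [C2 C2_ge0 int2] : exists2 C, 0 <= C & forall n,
    (\int[P]_w esup (Theta Tz Tt) (fun th => (((b n)^-1 *
     deriv_norm 2 (fun z => S n w (z, th.2)) th.1) `^ (M / eps0))%R) <= C%:E)%E.
  apply: (ereal_sup_range_bounded (moment_ge0 (M / eps0) ^~ 2%N)).
  apply: le_lt_trans (S_moments _ (Me _ eps0_gt0)).
  apply: le_trans; last by apply: leeDr; exact/sup_ge0/moment0_ge0.
  exact: (le_bigmax _ _ (Ordinal (isT : (2 < 4)%N))).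
have /choice[C3 C3P] : forall k, exists C, 0 <= C /\ forall n,
    (\int[P]_w esup Tt (fun t => (enorm (b n `^ eps1 *:
     ((b n)^-1 *: gradient (fun z => S n w (z, t) 0 k : R) z0 - dS0 k t))
     `^ (M / (2 * eps1)))%R) <= C%:E)%E.
  move=> k; have [|C ? ?] := ereal_sup_range_bounded
    (fun n => integral_esup_ge0 P Tt_ne (fun w x => powR_ge0 _ _))
    (dS0_moments (M / (2 * eps1)) k _).
    by rewrite Me// mulr_gt0.
  by exists C.
(* From [r0] on, [64 <= r * delta ^+ 2] holds and the near region, of radius [r] to the power
   [- eps0], lies in the cube inside [Tz]. *)
set r0 := Num.max (64 / delta ^+ 2) (rho^-1 `^ eps0^-1).
have r0_gt0 : 0 < r0 by rewrite lt_max divr_gt0// exprn_gt0.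
set c0 := delta / 2 / (Delta ^+ 2) `^ eps0.
set c1 := delta / (8 * p.+1%:R).
set c2 := delta / 4 / pz.+1%:R ^+ 2.
set c3 := delta / (4 * pz.+1%:R) / (Delta ^+ 2) `^ eps1.
set C := C0 / c0 `^ (M / eps0) + C1 / c1 `^ M + C2 / c2 `^ (M / eps0)
      + \sum_(k < p) C3 k / c3 `^ (M / (2 * eps1)).
have C_ge0 : 0 <= C.
  rewrite !addr_ge0 ?divr_ge0 ?powR_ge0// sumr_ge0// => k _.
  by rewrite divr_ge0 ?powR_ge0//; have [] := C3P k.
(* The first summand serves [r < r0], where the trivial bound 1 on the probability is enough. *)
exists (r0 `^ M + C); first by rewrite ltr_pwDl// powR_gt0.
move=> r r_gt0; apply: ge_ereal_sup => _ [n _ <-].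
have [r0r|rr0] := leP r0 r; last first.
  have mE := measurable_large_deviation_event b openTz openTt Tz0 S_random n r.
  apply: le_trans (probability_le1 P mE) _.
  rewrite lee_fin ler_pdivlMr ?powR_gt0// mul1r ler_wpDr//.
  by rewrite ge0_ler_powR ?nnegrE ?ltW.
apply: (@le_trans _ _ (C / r `^ M)%:E); last first.
  by rewrite lee_fin ler_pM2r ?invr_gt0 ?powR_gt0// lerDr powR_ge0.
move: r0r; rewrite ge_max => /andP[r64 r_rho].
have r_rho' : r `^ (- eps0) <= rho.
  rewrite powRN invf_ple ?posrE ?powR_gt0//.
  have -> : rho^-1 = (rho^-1 `^ eps0^-1) `^ eps0.
    by rewrite -powRrM mulVf ?gt_eqF// powRr1// invr_ge0 ltW.
  by apply: ge0_ler_powR; rewrite ?nnegrE ?powR_ge0// ltW.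
apply: (deviation_probability_le openTz openTt Tz0 Tt_ne S_random eps0_gt0
  eps1_gt0 Delta_gt0 M_gt0 delta01 delta_chi delta_lambda Tz_Delta Tz_rho
  S0_ge dS0_ge (b_gt0 n) _ _ r_rho' (int0 n) (int1 n) (int2 n)).
- by have [Sn _] := S_smooth n.
- by rewrite -ler_pdivrMr// exprn_gt0.
- by move=> k; have [_] := C3P k.
Qed.
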